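(* Let $k\ge2$ and let $\mathcal{H}$ be a connected $k$-graph with maximum degree $\Delta\ge2$. Then the cyclic index of $\mu(\mathcal{H},x)$ is $k$, $\lambda(\mathcal{H})$ is a simple root of $\mu(\mathcal{H},x)$, and $$\Delta^{1/k}\le\lambda(\mathcal{H})<\frac{k}{k-1}\big((k-1)(\Delta-1)\big)^{1/k}.$$
   Context: A $k$-graph ($k\ge2$) $\mathcal{H}$ consists of a finite vertex set $V(\mathcal{H})$ and a set $E(\mathcal{H})$ of $k$-element subsets of $V(\mathcal{H})$. The degree of a vertex is the number of edges containing it; $\Delta$ is the maximum degree. A matching is a set of pairwise disjoint edges; $p(\mathcal{H},r)$ is the number of matchings with $r$ edges ($p(\mathcal{H},0)=1$). The matching polynomial is $\mu(\mathcal{H},x)=\sum_{r\ge0}(-1)^r p(\mathcal{H},r)x^{|V(\mathcal{H})|-kr}$, and $\lambda(\mathcal{H})$ is the maximum modulus of its complex zeros. A path is an alternating sequence $(v_0,e_1,v_1,\dots,e_\ell,v_\ell)$ of distinct vertices and distinct edges with $v_i,v_{i+1}\in e_{i+1}$; $\mathcal{H}$ is connected if any two vertices are joined by a path. A real polynomial $f$ is $\ell$-symmetric if $f(x)=x^t g(x^\ell)$ for some integer $t\ge0$ and real polynomial $g$; the cyclic index of $f$ is the maximum $\ell$ for which $f$ is $\ell$-symmetric. *)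

(* Defs.v *)
From HB Require Import structures.
From mathcomp Require Import all_boot all_order all_algebra.
From mathcomp Require Import complex reals.

Set Implicit Arguments.
Unset Strict Implicit.
Unset Printing Implicit Defensive.

Import Order.TTheory GRing.Theory Num.Theory.
Local Open Scope ring_scope.

Section Hypergraph.

Variable V : finType.
Implicit Types (E M : {set {set V}}) (e : {set V}) (x y v : V).

Definition is_kgraph (k : nat) E : bool := [forall e in E, #|e| == k].

Definition degree E v : nat := #|[set e in E | v \in e]|.

Definition max_degree E : nat := (\max_(v : V) degree E v)%N.

(* [trivIset M] says that distinct members of M are disjoint. *)
Definition is_matching E M : bool := (M \subset E) && trivIset M.

Definition num_matchings E (r : nat) : nat :=
  #|[set M : {set {set V}} | is_matching E M & #|M| == r]|.

(* A walk (v_0, e_1, v_1, ..., e_l, v_l) is represented by its first vertex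
   [x] = v_0 and the sequence [p] of the pairs (e_i, v_i), 1 <= i <= l. *)
Fixpoint is_walk E x (p : seq ({set V} * V)) : bool :=
  if p is (e, y) :: p' then [&& e \in E, x \in e, y \in e & is_walk E y p']
  else true.

Definition is_path E x (p : seq ({set V} * V)) : bool :=
  [&& is_walk E x p, uniq (x :: unzip2 p) & uniq (unzip1 p)].

Definition connected_hypergraph E : Prop :=
  forall x y, exists2 p, is_path E x p & last x (unzip2 p) = y.

(* The subtraction is truncated, but for k >= 1 no matching of a k-graph has r
   edges with k * r > #|V|, so those coefficients vanish.  A matching has at
   most #|E| edges. *)
Definition matching_poly (R : realType) (k : nat) E : {poly R} :=
  \sum_(0 <= r < #|E|.+1)
     ((-1) ^+ r * (num_matchings E r)%:R) *: 'X^(#|V| - k * r).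

End Hypergraph.

Section RealPoly.

Variable R : realType.
Implicit Types f g : {poly R}.

(* The complex zeros, listed with multiplicity. *)
Definition complex_zeros f : seq (complex R) :=
  sval (closed_field_poly_normal (map_poly (real_complex R) f)).

Lemma mem_complex_zeros f (z : complex R) : f != 0 ->
  (z \in complex_zeros f) = root (map_poly (real_complex R) f) z.
Proof.
move=> f0; rewrite /complex_zeros; case: closed_field_poly_normal => r /= ->.
by rewrite rootZ ?lead_coef_eq0 ?map_poly_eq0 // root_prod_XsubC.
Qed.

(* The default value 0 only matters for polynomials without zeros, since
   moduli are nonnegative. *)
Definition max_modulus f : R :=
  \big[Num.max/0]_(z <- complex_zeros f) Normc.normc z.

Definition symmetric_poly (l : nat) f : Prop :=
  exists (t : nat) (g : {poly R}), f = 'X^t * (g \Po 'X^l).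

(* A monomial is l-symmetric for all l and has no cyclic index. *)
Definition is_cyclic_index f (l : nat) : Prop :=
  symmetric_poly l f /\ (forall m, symmetric_poly m f -> (m <= l)%N).

Definition simple_root f (a : R) : Prop := mup a f = 1%N.

End RealPoly.

(* Main.v *)
(** Write [mu_W] for the matching polynomial of the hypergraph induced on the
    vertex set [W].  Deleting a vertex [v] gives
    [mu_W = X mu_(W \ v) - sum_(e ni v) mu_(W \ e)], and
    [mu_W' = sum_(v in W) mu_(W \ v)].  Let [l] be the largest real zero of the
    product of all the [mu_W].  All the [mu_W] are nonnegative at [l], hence by
    the recursion a zero at [l] propagates to larger sets; if a minimal [W] with
    [mu_W(l) = 0] were cut by an edge [e], the recursion at [W U e] would be
    negative at [l].  So by connectedness [mu_V] is the only one vanishing at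
    [l], and the derivative formula makes [l] a simple zero.  The recursion also
    shows that [|mu_W(z)| / |mu_U(z)| >= mu_W(|z|) / mu_U(|z|)] for [U <= W] as
    soon as the right hand sides are positive, whence every complex zero has
    modulus at most [l].  For the upper bound, an induction on [W] gives
    [mu_W(x) > r mu_(W \ v)(x)], with [r = x (k - 1) / k], whenever [x] is at
    least the bound and [v] does not have full degree in [W]. *)

Require Import Defs.
From HB Require Import structures.
From mathcomp Require Import all_boot all_order all_algebra.
From mathcomp Require Import complex reals exp polyrcf.
From mathcomp Require Import zify ring lra.

Set Implicit Arguments.
Unset Strict Implicit.
Unset Printing Implicit Defensive.

Import Order.TTheory GRing.Theory Num.Theory.
Local Open Scope ring_scope.

Lemma setDD1 (T : finType) (A B : {set T}) a :
  a \in A -> (B :\ a) :\: (A :\ a) = B :\: A.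
Proof.
move=> aA; apply/setP => y; rewrite !inE.
by case: eqVneq => [->|]; rewrite ?aA //= andbT.
Qed.

(** * Matchings inside a vertex subset *)

Section SubsetMatchings.

Variables (V : finType) (E : {set {set V}}).
Implicit Types (U W e : {set V}) (M : {set {set V}}) (v : V).

Definition matching_in W M : bool := is_matching E M && (cover M \subset W).

Definition edges_at W v e : bool := [&& e \in E, v \in e & e \subset W].

Lemma matching_inP W M :
  reflect [/\ M \subset E,
              forall A B, A \in M -> B \in M -> A != B -> [disjoint A & B]
            & forall A, A \in M -> A \subset W] (matching_in W M).
Proof.
apply: (iffP andP) => [[/andP[ME /trivIsetP tM] /bigcupsP cM]|[ME tM cM]] //.
by split; [apply/andP; split => //; apply/trivIsetP | apply/bigcupsP].
Qed.

Lemma matching_inD1 W v M :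
  matching_in (W :\ v) M = matching_in W M && (v \notin cover M).
Proof. by rewrite /matching_in subsetD1 andbA. Qed.

(** Adding [e] maps the matchings of [W :\: e] bijectively to those of [W] that cover [v] by [e];
    the left side is the condition left by [partition_big] and [reindex_onto] in [mu_in_rec]. *)
Lemma matching_inU1 W v e M : edges_at W v e ->
  [&& matching_in W (e |: M), v \in cover (e |: M), pblock (e |: M) v == e
    & (e |: M) :\ e == M] = matching_in (W :\: e) M.
Proof.
case/and3P=> eE ve eW; apply/and4P/idP.
  case=> /matching_inP[ME tM cM] _ _ /eqP eM.
  have eNM : e \notin M by rewrite -eM setD11.
  apply/matching_inP; split=> [|A B AM BM|A AM].
  - by apply: subset_trans ME; apply: subsetUr.
  - by apply: tM; rewrite in_setU1 ?AM ?BM orbT.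
  rewrite subsetD cM ?in_setU1 ?AM ?orbT //=.
  apply: tM; rewrite ?in_setU1 ?eqxx ?AM ?orbT //.
  by apply: contraNneq eNM => <-.
case/matching_inP=> ME tM cM.
have eNM : e \notin M.
  by apply/negP => /cM/subsetP/(_ v ve); rewrite inE ve.
have dM A : A \in M -> [disjoint A & e].
  by move/cM; rewrite subsetD => /andP[].
have tU A B : A \in e |: M -> B \in e |: M -> A != B -> [disjoint A & B].
  rewrite !in_setU1 => /predU1P[->|AM] /predU1P[->|BM].
  - by rewrite eqxx.
  - by rewrite disjoint_sym dM.
  - by rewrite dM.
  - exact: tM.
split.
- apply/matching_inP; split => [||A] //.
    by rewrite subUset sub1set eE.
  rewrite in_setU1 => /predU1P[->//|/cM].
  by rewrite subsetD => /andP[].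
- by apply/bigcupP; exists e; rewrite ?setU11.
- by apply/eqP/def_pblock; rewrite ?setU11 //; apply/trivIsetP.
- by rewrite setU1K.
Qed.

(** * Matching polynomials of vertex subsets *)

Section Polynomials.

Variable K : comNzRingType.

(* The exponent counts the vertices of [W] missed by [M], which avoids the
   truncated subtraction of [matching_poly]. *)
Definition matching_term W M : {poly K} :=
  (-1) ^+ #|M| *: 'X^#|W :\: cover M|.

Definition mu_in W : {poly K} := \sum_(M | matching_in W M) matching_term W M.

Lemma matching_termD1 W v M : v \in W -> v \notin cover M ->
  matching_term W M = 'X * matching_term (W :\ v) M.
Proof.
move=> vW vM; rewrite /matching_term (cardsD1 v (W :\: _)) !inE vW vM.
by rewrite add1n exprS -scalerAr setDDl setUC -setDDl.
Qed.

Lemma matching_termU1 W e M : e \notin M ->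
  matching_term W (e |: M) = - matching_term (W :\: e) M.
Proof.
move=> eM; rewrite /matching_term cardsU1 eM add1n exprS mulN1r scaleNr.
by rewrite /cover bigcup_setU big_set1 setDDl.
Qed.

(** Matchings missing [v] give the first term; the others are sorted by the edge covering [v], whose
    removal flips the sign. *)
Lemma mu_in_rec W v : v \in W ->
  mu_in W =
    'X * mu_in (W :\ v) - \sum_(e | edges_at W v e) mu_in (W :\: e).
Proof.
move=> vW; rewrite /mu_in (bigID (fun M => v \notin cover M)) /=.
congr (_ + _).
  rewrite mulr_sumr; apply: eq_big => [M|M /andP[_ vM]].
    by rewrite matching_inD1.
  exact: matching_termD1.
rewrite (partition_big (fun M => pblock M v) (edges_at W v)) /=; last first.
  move=> M /andP[/matching_inP[ME tM cM]]; rewrite negbK => vM.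
  have eM := pblock_mem vM.
  by apply/and3P; split; [exact: (subsetP ME)|rewrite mem_pblock|exact: cM].
rewrite -sumrN; apply: eq_bigr => e ee.
rewrite (reindex_onto (fun M => e |: M) (fun M => M :\ e)) /=; last first.
  move=> M /andP[/andP[_]]; rewrite negbK => vM /eqP eM.
  by rewrite setD1K // -eM pblock_mem.
rewrite -sumrN; apply: eq_big => [M|M].
  by rewrite negbK -(matching_inU1 M ee) !andbA.
case/andP=> _ /eqP eM; apply: matching_termU1.
by rewrite -eM setD11.
Qed.

(** Differentiating the term of [M] brings down the number of vertices of [W] that [M] misses. *)
Lemma deriv_mu_in W : (mu_in W)^`() = \sum_(v in W) mu_in (W :\ v).
Proof.
rewrite /mu_in raddf_sum /=.
under [RHS]eq_bigr => v vW.
  under eq_bigl do rewrite matching_inD1.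
  over.
rewrite (exchange_big_dep (matching_in W)) /=; last by move=> v M _ /andP[].
apply: eq_bigr => M MW; rewrite /matching_term derivZ derivXn.
rewrite (eq_bigr (fun=> (-1) ^+ #|M| *: 'X^(#|W :\: cover M|.-1))); last first.
  move=> v /and3P[vW _ vM]; rewrite (cardsD1 v (W :\: _)) !inE vW vM.
  by rewrite add1n /= setDDl setUC -setDDl.
rewrite sumr_const scalerMnr; congr (_ *: (_ *+ _)).
by apply: eq_card => v; rewrite !inE MW /= [RHS]andbC.
Qed.

Lemma mu_in0 : set0 \notin E -> mu_in set0 = 1.
Proof.
move=> nE; rewrite /mu_in (big_pred1 set0) => [|M]; last first.
  apply/idP/eqP => [/matching_inP[ME _ cM]|->].
    apply/eqP; rewrite -subset0; apply/subsetP => A AM.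
    move: (cM _ AM) (subsetP ME _ AM); rewrite subset0 => /eqP->.
    by rewrite (negbTE nE).
  by apply/matching_inP; split => [|A B|A]; rewrite ?sub0set // inE.
by rewrite /matching_term cards0 set0D cards0 scale1r.
Qed.

End Polynomials.

Lemma map_mu_in (K L : comNzRingType) (f : {rmorphism K -> L}) W :
  map_poly f (mu_in K W) = mu_in L W.
Proof.
rewrite /mu_in rmorph_sum; apply: eq_bigr => M _.
by rewrite /matching_term /= map_polyZ map_polyXn rmorphXn rmorphN1.
Qed.

Lemma horner_mu_in_rec (K : comNzRingType) W v (x : K) : v \in W ->
  (mu_in K W).[x] = x * (mu_in K (W :\ v)).[x]
    - \sum_(e | edges_at W v e) (mu_in K (W :\: e)).[x].
Proof.
move=> vW; rewrite (mu_in_rec K vW) hornerD hornerN hornerM hornerX.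
by rewrite [X in _ - X = _]horner_sum.
Qed.

Lemma edges_at_subD1 W v e : edges_at W v e -> W :\: e \subset W :\ v.
Proof. by case/and3P=> _ ve _; rewrite setDS // sub1set. Qed.

(** Removing a vertex outside [U], the reverse triangle inequality at [z] is compared termwise with
    the recursion at its modulus. Cross-multiplying avoids dividing by values at [z] that might
    vanish. *)
Lemma mu_in_norm_ratio (C : numDomainType) (z : C) :
  (forall W, 0 < (mu_in C W).[`|z|]) -> forall U W, U \subset W ->
  `|(mu_in C U).[z]| * (mu_in C W).[`|z|]
    <= `|(mu_in C W).[z]| * (mu_in C U).[`|z|].
Proof.
move=> pos U W; have [n] := ubnP #|W|; elim: n U W => // n IHn U W.
rewrite ltnS => Wn UW.
have [->|UnW] := eqVneq U W; first by [].
have /subsetPn[v vW vU] : ~~ (W \subset U).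
  by apply: contra UnW => WU; rewrite eqEsubset UW WU.
have Wvn : (#|W :\ v| < n)%N by rewrite (leq_trans _ Wn) // (cardsD1 v W) vW.
have IHW (A : {set V}) : A \subset W :\ v ->
    `|(mu_in C A).[z]| * (mu_in C (W :\ v)).[`|z|]
    <= `|(mu_in C (W :\ v)).[z]| * (mu_in C A).[`|z|].
  exact: IHn.
have stepW : `|(mu_in C (W :\ v)).[z]| * (mu_in C W).[`|z|]
    <= `|(mu_in C W).[z]| * (mu_in C (W :\ v)).[`|z|].
  rewrite (horner_mu_in_rec z vW) (horner_mu_in_rec `|z| vW).
  set a := (mu_in C (W :\ v)).[z]; set q := (mu_in C (W :\ v)).[`|z|].
  have q0 : 0 <= q := ltW (pos _).
  apply: le_trans (ler_wpM2r q0 (lerB_dist _ _)).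
  rewrite mulrBr mulrBl lerB // ?normrM 1?mulrCA ?mulrA //.
  apply: le_trans (ler_wpM2r q0 (ler_norm_sum _ _ _)) _.
  rewrite mulr_suml mulr_sumr; apply: ler_sum => e ee.
  exact/IHW/edges_at_subD1.
have UWv : U \subset W :\ v by rewrite subsetD1 UW.
rewrite -(ler_pM2r (pos (W :\ v))) mulrAC.
apply: le_trans (ler_wpM2r (ltW (pos W)) (IHW _ UWv)) _.
by rewrite mulrAC [leRHS]mulrAC ler_wpM2r // ltW.
Qed.

Lemma mu_in_norm_neq0 (C : numDomainType) (z : C) : set0 \notin E ->
  (forall W, 0 < (mu_in C W).[`|z|]) ->
  forall W, (mu_in C W).[z] != 0.
Proof.
move=> nE pos W; have := mu_in_norm_ratio pos (sub0set W).
rewrite mu_in0 // !hornerE normr1 mul1r -normr_gt0.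
exact: lt_le_trans (pos W).
Qed.

(** * Degrees and edges across a vertex subset *)

Lemma degreeE v : degree E v = #|edges_at setT v|.
Proof.
rewrite /degree cardsE; apply: eq_card => e.
by rewrite -!topredE /= /edges_at subsetT andbT.
Qed.

Lemma card_edges_at_le W v : (#|edges_at W v| <= max_degree E)%N.
Proof.
apply: leq_trans (leq_bigmax v); rewrite degreeE; apply: subset_leq_card.
by apply/subsetP => e /and3P[eE ve _]; apply/and3P.
Qed.

Lemma card_edges_at_lt W v e : e \in E -> v \in e -> ~~ (e \subset W) ->
  (#|edges_at W v| < max_degree E)%N.
Proof.
move=> eE ve eW; apply: leq_trans (leq_bigmax v); rewrite degreeE.
apply/proper_card/properP; split.
  by apply/subsetP => f /and3P[fE vf _]; apply/and3P.
exists e; first by apply/and3P.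
by apply/negP => /and3P[_ _ eW']; rewrite eW' in eW.
Qed.

(** On a path from a vertex of [W] to one outside, the first edge not contained in [W] works. *)
Lemma connected_cut_edge W : connected_hypergraph E -> W != set0 -> W != setT ->
  exists2 e, e \in E & (W :&: e != set0) && ~~ (e \subset W).
Proof.
move=> conn /set0Pn[x xW] WT.
have [y yW] : exists y, y \notin W.
  by apply/existsP; rewrite -negb_forall; apply: contra WT => /forallP WA;
     apply/eqP/setP => y; rewrite inE WA.
have [p /and3P[xp _ _] py] := conn x y.
elim: p x xW xp py => [|[e u] p IHp] x xW /=.
  by move=> _ xy; rewrite -xy xW in yW.
case/and4P=> eE xe ue up uy.
have [eW|eW] := boolP (e \subset W); first exact: IHp (subsetP eW _ ue) up uy.
by exists e => //; rewrite eW andbT; apply/set0Pn; exists x; rewrite inE xW.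
Qed.

(** * Ratios of values at real points *)

Section RealZeros.

Variable R : rcfType.

Local Notation mu W x := (mu_in R W).[x].

(** The at most [N] subtracted terms are each below [mu (W :\ v) x / r], hence sum to at most
    [x - s] times [mu (W :\ v) x]. Without such terms, [s < x] gives strictness. *)
Lemma mu_in_vertex_ratio W v (x s r : R) N :
  v \in W -> s < x -> 0 < r -> (#|edges_at W v| <= N)%N ->
  N%:R <= (x - s) * r -> 0 < mu (W :\ v) x ->
  (forall e, edges_at W v e -> r * mu (W :\: e) x < mu (W :\ v) x) ->
  s * mu (W :\ v) x < mu W x.
Proof.
move=> vW sx r0 dN Ns a0 he; rewrite (horner_mu_in_rec x vW).
rewrite ltrBrDr addrC -ltrBrDr -mulrBl.
have [e ee|ne] := pickP (edges_at W v); last first.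
  by rewrite big_pred0 // mulr_gt0 // subr_gt0.
rewrite -(ltr_pM2l r0) mulr_sumr.
apply: (@lt_le_trans _ _ (\sum_(f | edges_at W v f) mu (W :\ v) x)).
  apply: ltr_sum => [|f]; last exact: he.
  by apply/hasP; exists e => //; rewrite mem_index_enum.
rewrite sumr_const mulrA -mulr_natl ler_pM2r // mulrC.
by apply: le_trans Ns; rewrite ler_nat.
Qed.

(** Deleting [A] vertex by vertex costs a factor [r] each time. The [leif] form gives the weak bound
    for the induction and the strict one for nonempty [A]. *)
Lemma mu_in_chain (W A : {set V}) (x r : R) : 0 < r -> A \subset W ->
  (forall U a, U \subset W -> a \in A -> a \in U ->
     r * mu (U :\ a) x < mu U x) ->
  r ^+ #|A| * mu (W :\: A) x <= mu W x ?= iff (A == set0).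
Proof.
move=> r0; have [n] := ubnP #|A|; elim: n W A => // n IHn W A.
rewrite ltnS => An AW h.
have [->|/set0Pn[a aA]] := eqVneq A set0.
  by rewrite cards0 mul1r setD0; apply/leif_refl.
apply/leifP; have cA := cardsD1 a A; rewrite aA in cA.
have aW := subsetP AW _ aA.
rewrite cA exprS -mulrA; apply: le_lt_trans (h W a (subxx _) aA aW).
rewrite ler_pM2l //.
rewrite -(setDD1 _ aA).
apply: (IHn _ _ _ _ _).1; first by move: An; rewrite cA.
  exact: setSD.
move=> U b UW /setD1P[_ bA] bU; apply: h => //.
by apply: subset_trans UW _; apply: subsetDl.
Qed.

Variable k : nat.
Hypotheses (hk : (2 <= k)%N) (hE : is_kgraph k E).

Lemma card_edge e : e \in E -> #|e| = k.
Proof. by move=> eE; apply/eqP/(forall_inP hE). Qed.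

Lemma set0_notin_edges : set0 \notin E.
Proof.
by apply/negP => /card_edge; rewrite cards0 => k0; have := hk; rewrite -k0.
Qed.

Lemma mu_in_gt0 (x r : R) : 0 < r -> r < x ->
  (max_degree E).-1%:R <= (x - r) * r ^+ k.-1 ->
  (max_degree E)%:R <= x * r ^+ k.-1 ->
  forall W, 0 < mu W x.
Proof.
move=> r0 rx h1 h2 W.
(* Positivity is proved together with the ratio bound at vertices not of full degree, as each feeds
   the induction step of the other. *)
suff: 0 < mu W x /\ forall v, v \in W -> (#|edges_at W v| < max_degree E)%N ->
    r * mu (W :\ v) x < mu W x by case.
have [n] := ubnP #|W|; elim: n W => // n IHn W; rewrite ltnS => Wn.
have rk0 : 0 < r ^+ k.-1 by rewrite exprn_gt0.
have IHv v : v \in W -> 0 < mu (W :\ v) x /\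
    forall e, edges_at W v e -> r ^+ k.-1 * mu (W :\: e) x < mu (W :\ v) x.
  move=> vW; have Wv : (#|W :\ v| < n)%N.
    by rewrite (leq_trans _ Wn) // (cardsD1 v W) vW.
  split=> [|e /and3P[eE ve eW]]; first by have [] := IHn _ Wv.
  have eA : #|e :\ v| = k.-1 by rewrite -(card_edge eE) (cardsD1 v e) ve.
  rewrite -(setDD1 _ ve).
  have A0 : e :\ v != set0.
    by rewrite -card_gt0 eA; case: (k) hk => [|[]].
  (* Without [v], the other vertices of [e] have lost the edge [e], so the ratio bound applies to
     all [k - 1] deletions. *)
  have := @mu_in_chain (W :\ v) (e :\ v) x r r0 (setSD _ eW).
  rewrite (negbTE A0) eA => /(_ _)/leifP; apply=> U a UW /setD1P[_ ae] aU.
  have Un : (#|U| < n)%N := leq_ltn_trans (subset_leq_card UW) Wv.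
  have [_] := IHn _ Un; apply=> //; apply: (card_edges_at_lt eE ae).
  by apply/negP => /subsetP/(_ v ve)/(subsetP UW); rewrite setD11.
split=> [|v vW dv]; last first.
  have [a0 he] := IHv v vW.
  apply: (mu_in_vertex_ratio vW rx rk0 _ h1 a0 he).
  by rewrite -ltnS (leq_trans dv) // leqSpred.
have [->|/set0Pn[v vW]] := eqVneq W set0.
  by rewrite mu_in0 ?hornerE ?set0_notin_edges.
(* Positivity is the case [s = 0], where [v] may have full degree. *)
have [a0 he] := IHv v vW; rewrite -[X in X < _](mul0r (mu (W :\ v) x)).
apply: mu_in_vertex_ratio (card_edges_at_le W v) _ a0 he => //.
  exact: lt_trans rx.
by rewrite subr0.
Qed.

(** As 0 is a root, the default value of the maximum is harmless. *)
Lemma exists_largest_root (p : {poly R}) : p != 0 -> root p 0 ->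
  exists2 l : R, root p l & 0 <= l /\ forall y, root p y -> y <= l.
Proof.
move=> p0 r0; pose l := \big[Num.max/0]_(y <- rootsR p) y.
have mem_s y : (y \in rootsR p) = root p y by rewrite -roots_on_rootsR.
exists l.
  rewrite /l big_seq; elim/big_ind: _ => [//|x y px py|y]; first by case: leP.
  by rewrite mem_s.
split=> [|y py]; first exact: bigmax_ge_id.
by apply: (@le_bigmax_seq _ _ _ _ 0 y xpredT id); rewrite ?mem_s.
Qed.

(** * The largest zero: existence, lower bound and simplicity *)

Hypothesis hconn : connected_hypergraph E.

Lemma mu_in_zero_mono (l : R) U W :
  0 <= l -> (forall A, 0 <= mu A l) ->
  U \subset W -> mu U l = 0 -> mu W l = 0.
Proof.
move=> l0 pos UW U0; have [n] := ubnP #|W|; elim: n W UW => // n IHn W UW.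
rewrite ltnS => Wn; have [<-//|UnW] := eqVneq U W.
have /subsetPn[v vW vU] : ~~ (W \subset U).
  by apply: contra UnW => WU; rewrite eqEsubset UW WU.
apply/eqP; rewrite eq_le pos andbT (horner_mu_in_rec l vW).
rewrite IHn ?subsetD1 ?UW //; last first.
  by rewrite (leq_trans _ Wn) // (cardsD1 v W) vW.
by rewrite mulr0 sub0r oppr_le0 sumr_ge0.
Qed.

Lemma largest_zero (c : R) : (0 < #|V|)%N -> 0 < c ->
  (forall x, c <= x -> forall W, 0 < mu W x) ->
  exists l : R, [/\ 0 <= l < c, forall x, l < x -> forall W, 0 < mu W x,
    mu setT l = 0 & forall W, W != setT -> 0 < mu W l].
Proof.
move=> /card_gt0P[v _] c0 posc; pose F : {poly R} := \prod_W mu_in R W.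
have rootF W y : root (mu_in R W) y -> root F y.
  move=> /rootP Wy; apply/rootP; rewrite /F horner_prod.
  by rewrite (bigD1 W) //= Wy mul0r.
have F0 : F != 0.
  apply/prodf_neq0 => W _; apply: contraTneq (posc c (lexx _) W) => ->.
  by rewrite horner0 ltxx.
(* Edges have at least two vertices, so the factor of [F] for a singleton is ['X]. *)
have rF0 : root F 0.
  apply: (rootF [set v]); apply/rootP; rewrite (horner_mu_in_rec 0 (set11 v)).
  rewrite mul0r sub0r big1 ?oppr0 // => e /and3P[eE ve].
  rewrite subset1 => /orP[/eqP ev|/eqP e0]; last by rewrite e0 inE in ve.
  by have := hk; rewrite -(card_edge eE) ev cards1.
have [l rl [l0 lmax]] := exists_largest_root F0 rF0.
(* Taken with [y = c], this gives positivity beyond [l] and nonnegativity at [l], since no zero of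
   [F] exceeds [l]. *)
have zeroW W (x y : R) : x <= y -> mu W x <= 0 -> 0 < mu W y ->
    exists2 z, x <= z & root (mu_in R W) z.
  move=> xy Wx Wy; have Wxy : mu W x <= 0 <= mu W y by rewrite Wx ltW.
  by have [z /andP[xz _] rz] := poly_ivt xy Wxy; exists z.
have lc : l < c.
  rewrite ltNge; apply/negP => cl; have := rl; apply/negP; rewrite /root.
  by rewrite horner_prod; apply/prodf_neq0 => W _; rewrite gt_eqF // posc.
have posl x : l < x -> forall W, 0 < mu W x.
  move=> lx W; rewrite ltNge; apply/negP => Wx.
  have [cx|xc] := leP c x; first by have := posc x cx W; rewrite ltNge Wx.
  have [z xz rz] := zeroW W x c (ltW xc) Wx (posc c (lexx _) W).
  by have := lmax _ (rootF _ _ rz); rewrite leNgt (lt_le_trans lx xz).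
have nnegl W : 0 <= mu W l.
  rewrite leNgt; apply/negP => Wl.
  have [z] := zeroW W l c (ltW lc) (ltW Wl) (posc c (lexx _) W).
  rewrite le_eqVlt => /predU1P[lz|lz] rz.
    by move: Wl; rewrite lz (rootP rz) ltxx.
  by have := lmax _ (rootF _ _ rz); rewrite leNgt lz.
have [W0 /eqP W0l] : exists W, mu W l == 0.
  apply/existsP; apply: contraLR rl; rewrite negb_exists => /forallP nz.
  by rewrite /root horner_prod; apply/prodf_neq0.
case: (@arg_minnP _ W0 (fun W => mu W l == 0) (fun W => #|W|)) => [|W Wl Wmin].
  exact/eqP.
have posW U : U \proper W -> 0 < mu U l.
  move=> UW; rewrite lt_def nnegl andbT; apply/negP => /Wmin.
  by rewrite leqNgt proper_card.
have WT : W = setT.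
  apply/eqP/negP => /negP WT; have Wn0 : W != set0.
    apply: contraTneq Wl => ->.
    by rewrite mu_in0 ?hornerE ?oner_neq0 ?set0_notin_edges.
  have [e eE /andP[We /subsetPn[u ue uW]]] := connected_cut_edge hconn Wn0 WT.
  (* Both [T] and [T :\ u] contain [W], so the recursion at [u] forces all subtracted terms to
     vanish, among them the value at [W :\: e], against the minimality of [W]. *)
  pose T := W :|: e.
  have uT : u \in T by rewrite inE ue orbT.
  have Tl : mu T l = 0.
    by apply: (mu_in_zero_mono l0 nnegl (subsetUl W e)); apply/eqP.
  have Tul : mu (T :\ u) l = 0.
    apply: (@mu_in_zero_mono l W _ l0 nnegl); last exact/eqP.
    by rewrite subsetD1 subsetUl.
  move: Tl; rewrite (horner_mu_in_rec l uT) Tul mulr0 sub0r => /eqP.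
  rewrite oppr_eq0 psumr_eq0 => [|f _]; last exact: nnegl.
  move=> /allP/(_ e); rewrite mem_index_enum /edges_at eE ue subsetUr.
  move=> /(_ isT).
  apply/negP; rewrite gt_eqF //= setDUl setDv setU0; apply: posW.
  rewrite properEneq subsetDl andbT; apply: contraNneq We => <-.
  by rewrite setIDAC setDIl setDv setI0.
exists l; split => //; first by rewrite l0.
  by rewrite -WT; apply/eqP.
by move=> U; rewrite -WT => UW; apply: posW; rewrite properEneq UW WT subsetT.
Qed.

(** Discarding the nonnegative subtracted sums leaves a factor [l] per deleted vertex. *)
Lemma mu_in_le_chain (l : R) (A W : {set V}) : 0 <= l ->
  (forall U, 0 <= mu U l) -> A \subset W ->
  mu W l <= l ^+ #|A| * mu (W :\: A) l.
Proof.
move=> l0 pos; have [n] := ubnP #|A|; elim: n A W => // n IHn A W.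
rewrite ltnS => An AW.
have [->|/set0Pn[a aA]] := eqVneq A set0; first by rewrite cards0 mul1r setD0.
have cA := cardsD1 a A; rewrite aA in cA.
have aW := subsetP AW _ aA.
have IH : mu (W :\ a) l <= l ^+ #|A :\ a| * mu (W :\: A) l.
  rewrite -(setDD1 _ aA).
  by apply: IHn; [move: An; rewrite cA | apply: setSD].
rewrite cA exprS -mulrA (horner_mu_in_rec l aW) lerBlDr.
apply: le_trans (ler_wpM2l l0 IH) _.
by rewrite lerDl sumr_ge0.
Qed.

(** At a vertex [v] of maximum degree, the recursion reads [l mu_(V \ v) = sum_(e ni v) mu_(V \ e)]
    at [l], and [mu_(V \ v) <= l ^ (k - 1) mu_(V \ e)] for each [e]. *)
Lemma max_degree_le_zero (l : R) : (0 < max_degree E)%N -> 0 <= l ->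
  mu setT l = 0 -> (forall W, W != setT -> 0 < mu W l) ->
  (max_degree E)%:R <= l ^+ k.
Proof.
move=> D0 l0 Tl posl.
have nnegl W : 0 <= mu W l.
  by have [->|/posl/ltW//] := eqVneq W setT; rewrite Tl.
have V0 : (0 < #|V|)%N.
  rewrite lt0n; apply: contraTneq D0 => V0.
  by rewrite /max_degree big_pred0 // => v; have := fintype0 v V0.
have [v vD] := bigop.eq_bigmax (degree E) V0; rewrite -/(max_degree E) in vD.
have a0 : 0 < mu (setT :\ v) l.
  by apply: posl; apply/eqP => /setP/(_ v); rewrite setD11 inE.
rewrite -(ler_pM2r a0) vD degreeE mulr_natl -sumr_const.
apply: (@le_trans _ _
    (\sum_(e in edges_at setT v) l ^+ k.-1 * mu (setT :\: e) l)).
  apply: ler_sum => e /and3P[eE ve _].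
  rewrite -(setDD1 _ ve).
  have -> : k.-1 = #|e :\ v| by rewrite -(card_edge eE) (cardsD1 v e) ve.
  by apply: mu_in_le_chain => //; apply: setSD; apply: subsetT.
rewrite -mulr_sumr; move: Tl; rewrite (horner_mu_in_rec l (in_setT v)).
move/eqP; rewrite subr_eq0 => /eqP <-.
by rewrite mulrA -exprSr prednK // (leq_trans _ hk).
Qed.

Lemma simple_root_mu_in (l : R) : (0 < #|V|)%N -> mu setT l = 0 ->
  (forall W, W != setT -> 0 < mu W l) -> mup l (mu_in R setT) = 1%N.
Proof.
move=> /card_gt0P[v _] Tl posl.
have dl : (mu_in R setT)^`().[l] != 0.
  rewrite gt_eqF // deriv_mu_in horner_sum.
  have posD1 u : 0 < mu (setT :\ u) l.
    by apply: posl; apply/eqP => /setP/(_ u); rewrite setD11 inE.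
  by rewrite (bigD1 v) ?inE //= ltr_wpDr // sumr_ge0 // => u _; apply: ltW.
have T0 : mu_in R setT != 0.
  by apply: contraNneq dl => ->; rewrite deriv0 horner0.
apply/eqP; rewrite eqn_leq -XsubC_dvd // dvdp_XsubCl (introT rootP Tl) andbT.
rewrite mup_leq //; apply: contra dl => /dvdpP[q ->].
by rewrite expr2 !derivM !(hornerXsubC, hornerD, hornerM)
  subrr !(mulr0, mul0r, addr0).
Qed.

End RealZeros.
End SubsetMatchings.

(** * Coefficients, cyclic index and complex zeros *)

Section MatchingPolynomial.

Variables (R : realType) (k : nat) (V : finType) (E : {set {set V}}).
Hypotheses (hk : (2 <= k)%N) (hE : is_kgraph k E).

Lemma card_cover_matching M : is_matching E M -> #|cover M| = (k * #|M|)%N.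
Proof.
case/andP=> ME /eqP <-; rewrite (eq_bigr (fun=> k)) => [|A AM].
  by rewrite sum_nat_const mulnC.
exact/(card_edge hE)/(subsetP ME).
Qed.

Lemma matching_poly_setT : matching_poly R k E = mu_in E R setT.
Proof.
rewrite /matching_poly /mu_in big_mkord.
(* [inord] is exact on matchings, which have at most [#|E|] edges. *)
pose card_in (M : {set {set V}}) : 'I_#|E|.+1 := inord #|M|.
rewrite (partition_big card_in xpredT) //=; apply: eq_bigr => r _.
rewrite /num_matchings -sum1_card natr_sum mulr_sumr scaler_suml.
apply: eq_big => [M|M]; rewrite inE.
  rewrite /matching_in subsetT andbT.
  case: (boolP (is_matching E M)) => //= /andP[ME _].
  by rewrite -val_eqE /= inordK // ltnS subset_leq_card.
case/andP=> EM /eqP <-; rewrite mulr1 /matching_term setTD.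
by rewrite (cardsCs (~: cover M)) setCK (card_cover_matching EM).
Qed.

Lemma num_matchings_gt r : (#|V| < k * r)%N -> num_matchings E r = 0%N.
Proof.
move=> Vr; apply: eq_card0 => M; rewrite !inE.
apply/negP => /andP[EM /eqP Mr]; move: Vr.
by rewrite -Mr -(card_cover_matching EM) ltnNge max_card.
Qed.

Lemma num_matchings0_gt0 : (0 < num_matchings E 0)%N.
Proof.
apply/card_gt0P; exists set0; rewrite inE cards0 eqxx andbT.
by rewrite /is_matching sub0set; apply/trivIsetP => A B; rewrite inE.
Qed.

Lemma num_matchings1_gt0 e : e \in E -> (0 < num_matchings E 1)%N.
Proof.
move=> eE; apply/card_gt0P; exists [set e]; rewrite inE cards1 eqxx andbT.
by rewrite /is_matching sub1set eE trivIset1.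
Qed.

(** Only exponents with [k * r > #|V|] are truncated, and these carry the coefficient 0; the others
    are distinct. *)
Lemma coef_matching_poly r : (r <= #|E|)%N -> (k * r <= #|V|)%N ->
  (matching_poly R k E)`_(#|V| - k * r) = (-1) ^+ r * (num_matchings E r)%:R.
Proof.
move=> rE rV; rewrite /matching_poly big_mkord coef_sum.
rewrite (bigD1 (inord r)) //= inordK ?ltnS // coefZ coefXn eqxx mulr1.
rewrite big1 ?addr0 // => i ir; rewrite coefZ coefXn.
have [iV|iV] := leqP (k * i) #|V|; last first.
  by rewrite num_matchings_gt // mulr0 mul0r.
case: eqP => [ri|]; last by rewrite mulr0.
case/negP: ir; apply/eqP/val_inj; rewrite /= inordK ?ltnS //.
have k0 : (0 < k)%N by apply: leq_trans hk.
by apply/eqP; rewrite -(eqn_pmul2l k0) -(eqn_sub2lE iV rV) ri.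
Qed.

Lemma cyclic_index_matching_poly e : e \in E ->
  is_cyclic_index (matching_poly R k E) k.
Proof.
move=> eE; have k0 : (0 < k)%N by apply: leq_trans hk.
split.
  (* For [k r <= #|V|], the exponent [#|V| - k r] equals [#|V| %% k + k (#|V| %/ k - r)]. *)
  exists (#|V| %% k)%N.
  exists (\sum_(0 <= r < #|E|.+1)
     ((-1) ^+ r * (num_matchings E r)%:R) *: 'X^(#|V| %/ k - r)).
  rewrite /matching_poly !big_mkord raddf_sum mulr_sumr.
  apply: eq_bigr => r _ /=.
  rewrite comp_polyZ -scalerAr.
  have [rV|rV] := leqP (k * r) #|V|; last first.
    by rewrite num_matchings_gt // mulr0 !scale0r.
  congr (_ *: _); rewrite comp_Xn_poly -exprM -exprD; congr ('X^ _).
  rewrite mulnBr addnBA; first by rewrite addnC (mulnC k (_ %/ _)%N) -divn_eq.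
  by rewrite leq_mul2l leq_divRL // mulnC rV orbT.
(* The empty matching and a single edge give nonzero coefficients at [#|V|] and [#|V| - k], so [m]
   divides [k]; the case [m = 0] is trivial. *)
move=> m [t [g fg]]; have [->//|m0] := posnP m.
have kV : (k <= #|V|)%N by rewrite -(card_edge hE eE) max_card.
have E1 : (1 <= #|E|)%N by apply/card_gt0P; exists e.
have dvd i : (matching_poly R k E)`_i != 0 -> (t <= i)%N && (m %| i - t)%N.
  rewrite fg coefXnM ltnNge; case: leqP => //= ti; last by rewrite eqxx.
  by rewrite coef_comp_poly_Xn //; case: ifP; rewrite ?eqxx.
have /dvd/andP[t0 m0'] : (matching_poly R k E)`_(#|V| - k * 0) != 0.
  by rewrite coef_matching_poly ?muln0 // mul1r pnatr_eq0 -lt0n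
    num_matchings0_gt0.
have /dvd/andP[t1 m1'] : (matching_poly R k E)`_(#|V| - k * 1) != 0.
  rewrite coef_matching_poly ?muln1 // mulN1r oppr_eq0 pnatr_eq0 -lt0n.
  exact: num_matchings1_gt0 eE.
apply: dvdn_leq => //; rewrite muln0 subn0 in m0' t0; rewrite muln1 in m1' t1.
have -> : k = (#|V| - t - (#|V| - k - t))%N by lia.
exact: dvdn_sub.
Qed.

Lemma max_modulus_matching_poly (l : R) : 0 <= l ->
  (forall x, l < x -> forall W, 0 < (mu_in E R W).[x]) ->
  (mu_in E R setT).[l] = 0 -> max_modulus (matching_poly R k E) = l.
Proof.
move=> l0 posl Tl; rewrite matching_poly_setT.
have T0 : mu_in E R setT != 0.
  by apply: contraTneq (posl (l + 1) _ setT) => [->|];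
     rewrite ?horner0 ?ltxx // ltrDl ltr01.
have normcE (z : complex R) : `|z| = (Normc.normc z)%:C%C by case: z.
apply/le_anti/andP; split.
  (* A zero of modulus beyond [l] is excluded by [mu_in_norm_neq0], with positivity transported
     along the embedding of the reals. *)
  rewrite /max_modulus big_seq; apply: bigmax_le => // z.
  rewrite mem_complex_zeros // (map_mu_in E (real_complex R)) leNgt.
  apply: contraL => lz.
  apply: mu_in_norm_neq0; first exact: set0_notin_edges hk hE.
  move=> W; rewrite normcE.
  by rewrite -(map_mu_in E (real_complex R)) horner_map ltcR posl.
have lz : l%:C%C \in complex_zeros (mu_in E R setT).
  by rewrite mem_complex_zeros // /root horner_map Tl rmorph0.
rewrite /max_modulus.
apply: le_trans (le_bigmax_seq 0 _ xpredT (@Normc.normc R) lz isT).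
by rewrite /= expr0n addr0 sqrtr_sqr ler_norm.
Qed.

End MatchingPolynomial.

(* The upper bound is the smallest [x] for which some [r] satisfies the third
   inequality: [(x - r) * r ^ (k - 1)] is maximal at [r = x * (k - 1) / k]. *)
Lemma hypertree_ratio (R : realType) (k D : nat) (x : R) :
  (2 <= k)%N -> (2 <= D)%N ->
  k%:R / (k%:R - 1) * ((k%:R - 1) * (D%:R - 1)) `^ (k%:R^-1) <= x ->
  let r := x * ((k%:R - 1) / k%:R) in
  [/\ 0 < r, r < x, D.-1%:R <= (x - r) * r ^+ k.-1 & D%:R <= x * r ^+ k.-1].
Proof.
case: k => [//|[//|j]] _; case: D => [//|[//|d]] _ /=.
set K : R := j.+2%:R; set y : R := _ `^ _ => cx.
have K2 : 2 <= K by rewrite ler_nat.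
have d1 : 1 <= d.+1%:R :> R by rewrite ler1n.
have Dd : d.+2%:R = d.+1%:R + 1 :> R by rewrite -natr1.
have b0 : 0 < (K - 1) * (d.+2%:R - 1) by rewrite Dd addrK mulr_gt0 //; lra.
have y0 : 0 < y by apply: powR_gt0.
have yk : y ^+ j.+2 = (K - 1) * d.+1%:R.
  rewrite -powR_mulrn ?ltW // /y -powRrM mulVf ?powRr1 ?ltW // ?Dd ?addrK //.
  by rewrite gt_eqF //; lra.
set q := (K - 1) / K.
have q0 : 0 < q by rewrite divr_gt0 //; lra.
have q1 : q < 1 by rewrite ltr_pdivrMr; lra.
(* The constant in [cx] is [y / q], so that [r = x * q] satisfies [r ^ k >= (k - 1) (D - 1)]. *)
have qy : y <= x * q.
  rewrite -ler_pdivrMr //; apply: le_trans cx; rewrite /q invf_div.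
  by rewrite mulrC.
have x0 : 0 < x by rewrite -(pmulr_lgt0 _ q0); apply: lt_le_trans qy.
have key : (K - 1) * d.+1%:R <= x * q * (x * q) ^+ j.+1.
  by rewrite -exprS -yk lerXn2r // nnegrE ltW // mulr_gt0.
have p0 : 0 < (x * q) ^+ j.+1 by rewrite exprn_gt0 // mulr_gt0.
set p := (x * q) ^+ j.+1 in key p0 *.
have h1 : d.+1%:R <= (x - x * q) * p.
  have -> : (x - x * q) * p = x * q * p / (K - 1).
    by rewrite /q; field; rewrite !gt_eqF //; lra.
  by rewrite ler_pdivlMr; [rewrite mulrC | lra].
split => //; first exact: mulr_gt0.
  by rewrite gtr_pMr.
(* Since [x = k (x - r)], the first inequality gives [x * p >= k (D - 1) >= 2 (D - 1) >= D]. *)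
have -> : x * p = K * ((x - x * q) * p).
  by rewrite /q; field; rewrite gt_eqF //; lra.
rewrite Dd; apply: (@le_trans _ _ (2 * d.+1%:R)); first by lra.
by apply: ler_pM => //; lra.
Qed.

Theorem theorem1p4 (R : realType) (k : nat) (V : finType) (E : {set {set V}})
    (hk : (2 <= k)%N) (hE : is_kgraph k E) (hconn : connected_hypergraph E)
    (hD : (2 <= max_degree E)%N) :
  let mu : {poly R} := matching_poly R k E in
  let lambda : R := max_modulus mu in
  let D : R := (max_degree E)%:R in
  [/\ is_cyclic_index mu k,
      simple_root mu lambda,
      D `^ (k%:R^-1) <= lambda
    & lambda < k%:R / (k%:R - 1) * (((k%:R - 1) * (D - 1)) `^ (k%:R^-1))].
Proof.
have k0 : (0 < k)%N by apply: leq_trans hk.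
have D0 : (0 < max_degree E)%N by apply: leq_trans hD.
have [e eE] : exists e, e \in E.
  apply/set0Pn; apply: contraTneq D0 => ->; rewrite /max_degree big1 // => v _.
  by apply: eq_card0 => e; rewrite !inE.
have V0 : (0 < #|V|)%N.
  by apply: leq_trans k0 _; rewrite -(card_edge hE eE) max_card.
move=> mu lambda D; set c := (X in lambda < X).
have c0 : 0 < c.
  have [r0 rc _ _] := hypertree_ratio hk hD (lexx c).
  exact: lt_trans rc.
(* Positivity already at [c] itself makes the upper bound strict. *)
have posc (x : R) : c <= x -> forall W, 0 < (mu_in E R W).[x].
  by move=> /(hypertree_ratio hk hD)[]; apply: mu_in_gt0.
have [l [/andP[l0 lc] posl Tl propl]] := largest_zero hk hE hconn V0 c0 posc.
have lE : lambda = l by apply: max_modulus_matching_poly.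
rewrite lE /simple_root /mu; split => //.
- exact: cyclic_index_matching_poly eE.
- by rewrite (matching_poly_setT _ hE); apply: simple_root_mu_in.
- have Dl := max_degree_le_zero hk hE D0 l0 Tl propl.
  have kV : k%:R * k%:R^-1 = 1 :> R by rewrite divff // pnatr_eq0 -lt0n.
  have Dk : D `^ k%:R^-1 <= (l ^+ k) `^ k%:R^-1.
    by rewrite ge0_ler_powR ?nnegrE ?invr_ge0 ?ler0n ?exprn_ge0.
  by rewrite -powR_mulrn // -powRrM kV powRr1 in Dk.
Qed.
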